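(* Let $L,M$ be metric spaces and let $(f_i:L\to M)_{i\in\mathbb N}$ be a uniformly equicontinuous sequence of uniformly continuous functions; let $\bar f: L_{u}\times(\mathbb N_{cof})_{diag}\to M_{u}$ be the associated morphism of $\mathrm{sFilt}$, given by $(i_1,\dots,i_n,x_1,\dots,x_n)\mapsto(f_{i_1}(x_1),\dots,f_{i_n}(x_n))$. The sequence $(f_i)$ converges uniformly to some uniformly continuous function $f_\infty:L\to M$ if and only if there is a morphism $\tilde f:L_{u}[+1]\times(\mathbb N_{cof})_{diag}\to M_{u}[+1]$ in $\mathrm{sFilt}$ such that $$[-1]\circ\tilde f=\bar f\circ([-1]\times\mathrm{id}).$$ Moreover, such a $\tilde f$ is necessarily of the form $$\mathbb N^n\times L^{n+1}\to M^{n+1},\quad (i_1,\dots,i_n,x_0,x_1,\dots,x_n)\mapsto(f_\infty(x_0),f_{i_1}(x_1),\dots,f_{i_n}(x_n)),$$ where $f_\infty$ is the uniform limit.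
   Context: A filter on a set $X$ is a collection of subsets of $X$, called neighbourhoods, closed under finite intersections (in particular containing $X$) and under passing to supersets; $\emptyset$ is allowed to be a neighbourhood and $X$ is allowed to be empty. A morphism of filters (a continuous map) is a function of the underlying sets such that the preimage of every neighbourhood is a neighbourhood. $\mathrm{Filt}$ is the category of filters. $\Delta$ is the category of finite linear orders $n_\le=\{0<\dots<n-1\}$, $n\ge 1$, and non-decreasing maps, and $\mathrm{sFilt}=\mathrm{Fun}(\Delta^{op},\mathrm{Filt})$ is the category of simplicial filters; a morphism in $\mathrm{sFilt}$ is a map of the underlying simplicial sets which is continuous at every level. Products in $\mathrm{sFilt}$ are levelwise products of filters (a neighbourhood in the product is a set containing a product of neighbourhoods). Shift: $[+1]:\Delta\to\Delta$ adds a new minimal element (preserved by morphisms), and $X[+1]:=X\circ[+1]$, so $X[+1](n_\le)=X((n+1)_\le)$ as filters. The inclusions $n_\le\to (n+1)_\le$ omitting the new minimal element give a natural morphism $[-1]:X[+1]\to X$. For a metric space $M$, $M_{u}\in\mathrm{sFilt}$ has underlying simplicial set $n_\le\mapsto \mathrm{Hom}_{\mathrm{Sets}}(n,M)=M^n$, and $\varepsilon\subset M^n$ is a neighbourhood iff there is $\epsilon>0$ such that $(x_1,\dots,x_n)\in\varepsilon$ whenever $\mathrm{dist}(x_i,x_j)<\epsilon$ for all $i,j$. Thus $[-1]:M_{u}[+1]\to M_{u}$ is the projection $M\times M^n\to M^n$ forgetting the first coordinate. $(\mathbb N_{cof})_{diag}$ has underlying simplicial set $n_\le\mapsto\mathbb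 N^n$, where a subset of $\mathbb N^n$ is a neighbourhood iff it contains $\{(i,i,\dots,i): i>N\}$ for some $N>0$. Uniform equicontinuity of $(f_i)$ means: for every $\epsilon>0$ there is $\delta>0$ such that $\mathrm{dist}(f_i(x),f_i(y))<\epsilon$ for all $i$ and all $x,y\in L$ with $\mathrm{dist}(x,y)<\delta$. *)

(* Defs.v *)
From mathcomp Require Import all_boot all_order all_algebra.
From mathcomp Require Import boolp classical_sets functions filter.
From mathcomp Require Import reals topology.

Set Implicit Arguments.
Unset Strict Implicit.
Unset Printing Implicit Defensive.

Import Order.TTheory GRing.Theory Num.Theory.
Local Open Scope classical_set_scope.
Local Open Scope ring_scope.

(* [Filter], unlike [ProperFilter], allows the empty set as a neighbourhood. *)
Record filt := Filt {
  carrier :> Type ;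
  nbh : set_system carrier ;
  nbh_filter : Filter nbh }.
Arguments nbh : clear implicits.
#[global] Existing Instance nbh_filter.

Record fhom (X Y : filt) := FHom {
  fhom_fun :> X -> Y ;
  fhom_cont : forall A : set Y, nbh Y A -> nbh X (fhom_fun @^-1` A) }.

Definition fid (X : filt) : fhom X X := @FHom X X idfun (fun A nA => nA).

Definition fcomp (X Y Z : filt) (g : fhom Y Z) (f : fhom X Y) : fhom X Z :=
  @FHom X Z (g \o f) (fun A nA => fhom_cont f (fhom_cont g nA)).

Definition fprod (X Y : filt) : filt :=
  @Filt (X * Y)%type (filter_prod (nbh X) (nbh Y)) _.

Lemma fprod_map_cont (X Y X' Y' : filt) (f : fhom X X') (g : fhom Y Y')
    (A : set (fprod X' Y')) : nbh (fprod X' Y') A ->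
  nbh (fprod X Y) ((fun p : fprod X Y => (f p.1, g p.2)) @^-1` A).
Proof.
move=> [[P Q] /= [nP nQ] PQA].
exists (f @^-1` P, g @^-1` Q); first by split; exact: fhom_cont.
by move=> [x y] [/= Px Qy]; apply: PQA.
Qed.

Definition fprod_map (X Y X' Y' : filt) (f : fhom X X') (g : fhom Y Y') :
    fhom (fprod X Y) (fprod X' Y') :=
  @FHom (fprod X Y) (fprod X' Y') (fun p => (f p.1, g p.2))
    (@fprod_map_cont X Y X' Y' f g).

(* The object [n : nat] stands for the linear order 0 < ... < n with n.+1
   elements, so that [nat] enumerates exactly the nonempty orders. *)
Record dhom (m n : nat) := DHom {
  dhom_fun :> 'I_m.+1 -> 'I_n.+1 ;
  dhom_homo : {homo dhom_fun : i j / (i <= j)%N} }.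

Lemma dhom_ext m n (a b : dhom m n) : a =1 b -> a = b.
Proof.
case: a b => [a ha] [b hb] /= /funext ab; case: _ / ab in hb *.
by rewrite (Prop_irrelevance ha hb).
Qed.

Definition did n : dhom n n := @DHom n n idfun (fun i j ij => ij).

Definition dcomp m n p (b : dhom n p) (a : dhom m n) : dhom m p :=
  @DHom m p (b \o a) (fun i j ij => dhom_homo b (dhom_homo a ij)).

(* The functor [+1] on morphisms: the new minimal element is [ord0], and the
   old elements are embedded by [lift ord0]. *)
Definition dshift_fun m n (a : 'I_m.+1 -> 'I_n.+1) (i : 'I_m.+2) : 'I_n.+2 :=
  if unlift ord0 i is Some j then lift ord0 (a j) else ord0.

Lemma dshift_homo m n (a : dhom m n) :
  {homo dshift_fun a : i j / (i <= j)%N}.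
Proof.
move=> i j; rewrite /dshift_fun.
by case: unliftP => [i'|] ->; case: unliftP => [j'|] -> //;
  rewrite !lift0 ltnS // => /(dhom_homo a).
Qed.

Definition dshift m n (a : dhom m n) : dhom m.+1 n.+1 :=
  DHom (@dshift_homo m n a).

Lemma dskip_homo n : {homo lift (@ord0 n.+1) : i j / (i <= j)%N}.
Proof. by move=> i j ij; rewrite !lift0. Qed.

Definition dskip n : dhom n n.+1 := DHom (@dskip_homo n).

Lemma dshift_id n : dshift (did n) = did n.+1.
Proof.
by apply: dhom_ext => i; rewrite /= /dshift_fun; case: unliftP => [j|] ->.
Qed.

Lemma dshift_comp m n p (b : dhom n p) (a : dhom m n) :
  dshift (dcomp b a) = dcomp (dshift b) (dshift a).
Proof.
apply: dhom_ext => i; rewrite /= /dshift_fun.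
by case: (unliftP ord0 i) => [j|] _; rewrite ?liftK ?unlift_none.
Qed.

Lemma dskip_nat m n (a : dhom m n) :
  dcomp (dskip n) a = dcomp (dshift a) (dskip m).
Proof. by apply: dhom_ext => i; rewrite /= /dshift_fun liftK. Qed.

Record sfilt := SFilt {
  sobj :> nat -> filt ;
  smap : forall m n, dhom m n -> fhom (sobj n) (sobj m) ;
  smap_id : forall n, smap (did n) =1 idfun ;
  smap_comp : forall m n p (b : dhom n p) (a : dhom m n),
    smap (dcomp b a) =1 smap a \o smap b }.

Record shom (X Y : sfilt) := SHom {
  shom_fun :> forall n, fhom (X n) (Y n) ;
  shom_nat : forall m n (a : dhom m n),
    shom_fun m \o smap X a =1 smap Y a \o shom_fun n }.

Definition sid (X : sfilt) : shom X X :=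
  @SHom X X (fun n => fid (X n)) (fun m n a x => erefl).

Lemma scomp_nat (X Y Z : sfilt) (g : shom Y Z) (f : shom X Y) m n
    (a : dhom m n) :
  fcomp (g m) (f m) \o smap X a =1 smap Z a \o fcomp (g n) (f n).
Proof.
move=> x /=.
have /= -> := shom_nat f a x.
by have /= -> := shom_nat g a (f n x).
Qed.

Definition scomp (X Y Z : sfilt) (g : shom Y Z) (f : shom X Y) : shom X Z :=
  @SHom X Z (fun n => fcomp (g n) (f n)) (@scomp_nat X Y Z g f).

Lemma sprod_id (X Y : sfilt) n :
  fprod_map (smap X (did n)) (smap Y (did n)) =1 idfun.
Proof. by move=> [x y] /=; rewrite !smap_id. Qed.

Lemma sprod_comp (X Y : sfilt) m n p (b : dhom n p) (a : dhom m n) :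
  fprod_map (smap X (dcomp b a)) (smap Y (dcomp b a)) =1
  fprod_map (smap X a) (smap Y a) \o fprod_map (smap X b) (smap Y b).
Proof. by move=> [x y] /=; rewrite !smap_comp. Qed.

Definition sprod (X Y : sfilt) : sfilt :=
  @SFilt (fun n => fprod (X n) (Y n))
    (fun m n a => fprod_map (smap X a) (smap Y a))
    (@sprod_id X Y) (@sprod_comp X Y).

Lemma sprod_map_nat (X Y X' Y' : sfilt) (f : shom X X') (g : shom Y Y') m n
    (a : dhom m n) :
  fprod_map (f m) (g m) \o smap (sprod X Y) a =1
  smap (sprod X' Y') a \o fprod_map (f n) (g n).
Proof.
move=> [x y] /=.
have /= -> := shom_nat f a x.
by have /= -> := shom_nat g a y.
Qed.

Definition sprod_map (X Y X' Y' : sfilt) (f : shom X X') (g : shom Y Y') :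
    shom (sprod X Y) (sprod X' Y') :=
  @SHom (sprod X Y) (sprod X' Y') (fun n => fprod_map (f n) (g n))
    (@sprod_map_nat X Y X' Y' f g).

Lemma sshift_id (X : sfilt) n : smap X (dshift (did n)) =1 idfun.
Proof. by move=> x; rewrite dshift_id smap_id. Qed.

Lemma sshift_comp (X : sfilt) m n p (b : dhom n p) (a : dhom m n) :
  smap X (dshift (dcomp b a)) =1 smap X (dshift a) \o smap X (dshift b).
Proof. by move=> x; rewrite dshift_comp smap_comp. Qed.

Definition sshift (X : sfilt) : sfilt :=
  @SFilt (fun n => X n.+1) (fun m n a => smap X (dshift a))
    (@sshift_id X) (@sshift_comp X).

Lemma sunshift_nat (X : sfilt) m n (a : dhom m n) :
  smap X (dskip m) \o smap (sshift X) a =1 smap X a \o smap X (dskip n).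
Proof.
move=> x; have /= <- := @smap_comp X _ _ _ (dshift a) (dskip m) x.
by rewrite -dskip_nat smap_comp.
Qed.

(* The natural morphism [-1] : X[+1] -> X. *)
Definition sunshift (X : sfilt) : shom (sshift X) X :=
  @SHom (sshift X) X (fun n => smap X (dskip n)) (@sunshift_nat X).

Section Metric.
Variables (R : realType) (M : metricType R).

Definition metric_nbh (n : nat) : set_system ('I_n -> M) :=
  filter_from [set e : R | 0 < e]
    (fun e => [set x | forall i j, mdist (x i) (x j) < e]).

Lemma metric_nbh_filter n : Filter (@metric_nbh n).
Proof.
apply: filter_from_filter; first by exists 1 => /=.
move=> d e /= d0 e0; exists (Num.min d e); first by rewrite /= lt_min d0.
by move=> x xde; split=> i j; have := xde i j; rewrite lt_min => /andP[].
Qed.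

(* Indexed by the number of coordinates; the object [n : nat] of Delta has n.+1
   elements, hence the shift of index in [sfilt_metric]. *)
Definition metric_filt (n : nat) : filt := Filt (metric_nbh_filter n).

Lemma metric_map_cont m n (a : 'I_m -> 'I_n) (A : set (metric_filt m)) :
  nbh (metric_filt m) A ->
  nbh (metric_filt n) ((fun x : 'I_n -> M => x \o a) @^-1` A).
Proof. by move=> [e e0 eA]; exists e => // x xe; apply: eA => i j /=. Qed.

Definition sfilt_metric : sfilt :=
  @SFilt (fun n => metric_filt n.+1)
    (fun m n a => FHom (@metric_map_cont m.+1 n.+1 a))
    (fun n x => erefl) (fun m n p b a x => erefl).

End Metric.

Definition diag_nbh (n : nat) : set_system ('I_n -> nat) :=
  filter_from [set N | (0 < N)%N]
    (fun N => [set (fun=> i) | i in [set i | (N < i)%N]]).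

Lemma diag_nbh_filter n : Filter (@diag_nbh n).
Proof.
apply: filter_from_filter; first by exists 1%N.
move=> N P /= N0 P0; exists (maxn N P); first by rewrite /= leq_max N0.
by move=> _ [i /= + <-]; rewrite gtn_max => /andP[Ni Pi]; split; exists i.
Qed.

Definition diag_filt (n : nat) : filt := Filt (diag_nbh_filter n).

Lemma diag_map_cont m n (a : 'I_m -> 'I_n) (A : set (diag_filt m)) :
  nbh (diag_filt m) A ->
  nbh (diag_filt n) ((fun x : 'I_n -> nat => x \o a) @^-1` A).
Proof.
move=> [N N0 NA]; exists N => // _ [i Ni <-].
by apply: NA; exists i.
Qed.

Definition sfilt_Ncof_diag : sfilt :=
  @SFilt (fun n => diag_filt n.+1)
    (fun m n a => FHom (@diag_map_cont m.+1 n.+1 a))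
    (fun n x => erefl) (fun m n p b a x => erefl).

Section Sequence.
Variables (R : realType) (L M : metricType R).
Implicit Type f : nat -> L -> M.

Definition unif_equicontinuous f :=
  forall e : R, 0 < e -> exists2 d : R, 0 < d &
    forall i x y, mdist x y < d -> mdist (f i x) (f i y) < e.

Definition seq_fun f n (p : ('I_n -> L) * ('I_n -> nat)) : 'I_n -> M :=
  fun k => f (p.2 k) (p.1 k).

Lemma seq_fun_cont f (hf : unif_equicontinuous f) n
    (A : set (metric_filt M n)) : nbh (metric_filt M n) A ->
  nbh (fprod (metric_filt L n) (diag_filt n)) (@seq_fun f n @^-1` A).
Proof.
move=> [e e0 eA]; have [d d0 hd] := hf _ e0.
exists ([set x | forall i j, mdist (x i) (x j) < d],
        [set (fun=> i) | i in [set i | (1 < i)%N]]).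
  by split; [exists d | exists 1%N].
by move=> [x _] [/= xd [i _ <-]]; apply: eA => j k; exact: hd.
Qed.

(* [hf] is only used to prove continuity; the underlying map is [seq_fun f]. *)
Definition seq_shom f (hf : unif_equicontinuous f) :
    shom (sprod (sfilt_metric L) sfilt_Ncof_diag) (sfilt_metric M) :=
  @SHom (sprod (sfilt_metric L) sfilt_Ncof_diag) (sfilt_metric M)
    (fun n => FHom (seq_fun_cont hf (n := n.+1))) (fun m n a x => erefl).

(* (x_0, ..., x_n), (i_1, ..., i_n) |-> (g x_0, f_(i_1) x_1, ..., f_(i_n) x_n) *)
Definition lift_fun f (g : L -> M) n
    (p : ('I_n.+1 -> L) * ('I_n -> nat)) : 'I_n.+1 -> M :=
  fun k => if unlift ord0 k is Some j then f (p.2 j) (p.1 (lift ord0 j))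
           else g (p.1 ord0).

End Sequence.

(* Main.v *)
Require Import Defs.
From mathcomp Require Import all_boot all_order all_algebra.
From mathcomp Require Import boolp classical_sets functions filter.
From mathcomp Require Import reals topology.

(** At level 0 (one index, two points) a lift [ft] has the form
    (x0, x1, i) |-> (g (x0, x1, i), f_i x1).  Comparing the two vertices of a
    1-simplex shows that g (x0, x1, i) does not depend on (x1, i), so it is a
    function finf of x0.  Continuity of [ft] at level 0 says that finf x0 and
    f_i x1 are close as soon as x0 and x1 are close and i is large: on the
    diagonal x0 = x1 this is uniform convergence, and passing through f_i y it
    gives uniform continuity of finf. *)

Import Order.TTheory GRing.Theory Num.Theory.
Local Open Scope classical_set_scope.
Local Open Scope ring_scope.

Lemma fhom_ext (X Y : filt) (g h : fhom X Y) : g =1 h -> g = h.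
Proof.
case: g h => [g gc] [h hc] /= /funext gh; case: _ / gh in hc *.
by rewrite (Prop_irrelevance gc hc).
Qed.

(** Naturality and continuity are propositions, so only the underlying maps matter; this reduces the
    lifting equation to a computation on points. *)
Lemma shom_ext (X Y : sfilt) (g h : shom X Y) :
  (forall n, g n =1 h n) -> g = h.
Proof.
case: g h => [g gn] [h hn] /= gh.
have {}gh : g = h by apply: functional_extensionality_dep => n; apply: fhom_ext.
by case: _ / gh in hn *; rewrite (Prop_irrelevance gn hn).
Qed.

Section MetricEpsilon.
Variables (R : realType) (L M : metricType R).

Lemma metric_unif_continuousP (g : L -> M) : unif_continuous g <->
  forall e : R, 0 < e -> exists2 d : R, 0 < d &
    forall x y, mdist x y < d -> mdist (g x) (g y) < e.
Proof.
rewrite unif_continuousP; split=> gc e e0; have [d /= d0 gd] := gc e e0.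
  exists d => // x y xy; have := gd (x, y); rewrite /= !ballEmdist; exact.
by exists d => // -[x y] /=; rewrite !ballEmdist => /gd.
Qed.

(** The strict bound [N < i] matches the tails that generate [diag_nbh]. *)
Lemma metric_cvg_uniformP (f : nat -> L -> M) (g : L -> M) :
  {uniform, f @ \oo --> g} <->
  forall e : R, 0 < e -> exists N : nat,
    forall i x, (N < i)%N -> mdist (g x) (f i x) < e.
Proof.
split=> [fg e e0|fg P].
  have /fg [N _ NP] : nbhs (g : {uniform L -> M})
      [set h | forall x, mdist (g x) (h x) < e].
    apply/uniform_nbhs; exists [set xy | ball xy.1 e xy.2]; split.
      by rewrite -entourage_ballE; exists e.
    by move=> h /= gh x; have := gh x I; rewrite ballEmdist.
  by exists N => i x /ltnW /NP.
move=> /uniform_nbhs[E [+ EP]]; rewrite -entourage_ballE => -[e /= e0 eE].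
(* Tails for [\oo] are given by a non-strict bound, hence [N.+1]. *)
have [N NP] := fg e e0; exists N.+1 => // i /= Ni; apply: EP => /= x _.
by apply: eE; rewrite /= ballEmdist; exact: NP.
Qed.

End MetricEpsilon.

Lemma const_dhom_homo n (k : 'I_n.+1) :
  {homo (fun=> k) : i j / ((i : 'I_1) <= j)%N >-> (i <= j)%N}.
Proof. by []. Qed.

Definition vertex n (k : 'I_n.+1) : dhom 0 n := DHom (@const_dhom_homo n k).

Section Lift.
Variables (R : realType) (L M : metricType R) (f : nat -> L -> M).

Lemma lift_fun_nat (g : L -> M) m n (a : dhom m n)
    (p : ('I_n.+2 -> L) * ('I_n.+1 -> nat)) :
  lift_fun f g (p.1 \o dshift a, p.2 \o a) = lift_fun f g p \o dshift a.
Proof.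
apply/funext => k; rewrite /lift_fun /= /dshift_fun.
case: (unliftP ord0 k) => [j|] _ /=; last by rewrite !unlift_none.
by rewrite !liftK.
Qed.

Lemma lift_fun_cont (g : L -> M) n (A : set (metric_filt M n.+1)) :
  unif_equicontinuous f -> {uniform, f @ \oo --> g} ->
  nbh (metric_filt M n.+1) A ->
  nbh (Defs.fprod (metric_filt L n.+1) (diag_filt n)) (@lift_fun _ _ _ f g n @^-1` A).
Proof.
move=> f_equi /metric_cvg_uniformP fg [e /= e0 eA].
have e20 : 0 < e / 2 by rewrite divr_gt0.
have [d d0 fd] := f_equi _ e20; have [N fN] := fg _ e20.
(* A threshold in [diag_nbh] must be positive, while [N] may be 0. *)
exists ([set x | forall i j, mdist (x i) (x j) < d],
        [set (fun=> i) | i in [set i | (N.+1 < i)%N]]).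
  by split; [exists d | exists N.+1].
move=> [x _] [/= xd [i /ltnW Ni <-]]; apply: eA => /=.
(* Head against tail: pass through [f i y], using uniform convergence at [y] and then
   equicontinuity. *)
have gf y z : mdist y z < d -> mdist (g y) (f i z) < e.
  move=> /(fd i) yz; rewrite (le_lt_trans (metric_triangle _ (f i y) _))//.
  by rewrite (splitr e) ltrD// fN.
move=> j k; rewrite /lift_fun /=.
case: unliftP => [j'|] _; case: unliftP => [k'|] _.
- by rewrite (lt_trans (fd _ _ _ (xd _ _)))// ltr_pdivrMr// ltr_pMr// ltr1n.
- by rewrite metric_sym gf.
- exact: gf.
- by rewrite mdistxx.
Qed.

Definition lift_shom (g : L -> M) (f_equi : unif_equicontinuous f)
    (fg : {uniform, f @ \oo --> g}) :
    shom (sprod (sshift (sfilt_metric L)) sfilt_Ncof_diag)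
         (sshift (sfilt_metric M)) :=
  @SHom (sprod (sshift (sfilt_metric L)) sfilt_Ncof_diag)
        (sshift (sfilt_metric M))
    (fun n => FHom (fun A => @lift_fun_cont g n.+1 A f_equi fg))
    (@lift_fun_nat g).

Variable ft : shom (sprod (sshift (sfilt_metric L)) sfilt_Ncof_diag)
                   (sshift (sfilt_metric M)).

(** The second point [x] and the index 0 are arbitrary choices; [lift_head0] shows that they do not
    affect the value. *)
Definition lift_head (x : L) : M := ft 0%N (fun=> x, fun=> 0%N) ord0.

(** Naturality along a vertex: a shifted map fixes the new minimum, so the head coordinate is the
    same at every vertex of a simplex. *)
Lemma lift_vertex n (k : 'I_n.+1) (p : ('I_n.+2 -> L) * ('I_n.+1 -> nat)) :
  ft 0%N (p.1 \o dshift (vertex n k), fun=> p.2 k) ord0 = ft n p ord0.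
Proof.
have /= /(congr1 (fun h => h ord0)) /= := shom_nat ft (vertex n k) p.
by rewrite [dshift_fun _ _]/dshift_fun unlift_none.
Qed.

Lemma lift_head0 (p : ('I_2 -> L) * ('I_1 -> nat)) :
  ft 0%N p ord0 = lift_head (p.1 ord0).
Proof.
(* The 1-simplex with points (x0, x1, x0) and indices (i, 0): its first vertex is [p], its last is
   the point defining [lift_head] at x0. *)
pose q : ('I_3 -> L) * ('I_2 -> nat) :=
  (fun k => if val k == 1%N then p.1 (lift ord0 ord0) else p.1 ord0,
   fun k => if val k == 0%N then p.2 ord0 else 0%N).
have -> : p = (q.1 \o dshift (vertex 1 ord0), fun=> q.2 ord0).
  case: p @q => x i q; congr pair; apply/funext => k /=; last by rewrite ord1.
  by rewrite /dshift_fun; case: unliftP => [j|] ->; rewrite ?ord1.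
rewrite lift_vertex -(lift_vertex 1 ord_max); congr (ft 0%N _ ord0).
congr pair; apply/funext => k /=; rewrite /dshift_fun unlift_none.
by case: unliftP.
Qed.

Lemma lift_headE n (p : ('I_n.+2 -> L) * ('I_n.+1 -> nat)) :
  ft n p ord0 = lift_head (p.1 ord0).
Proof.
rewrite -(lift_vertex n ord0) lift_head0 /= /dshift_fun.
by rewrite unlift_none.
Qed.

(** The lifting equation, read coordinate by coordinate. *)
Hypothesis ft_tail : forall n (p : ('I_n.+2 -> L) * ('I_n.+1 -> nat)) k,
  ft n p (lift ord0 k) = f (p.2 k) (p.1 (lift ord0 k)).

Lemma lift_fun_head n : ft n =1 lift_fun f lift_head (n := n.+1).
Proof.
move=> p; apply/funext => k; rewrite /lift_fun.
by case: unliftP => [j|] ->; [exact: ft_tail | exact: lift_headE].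
Qed.

Lemma lift_head_close (e : R) : 0 < e -> exists2 d : R, 0 < d &
  exists N : nat, forall i x y, (N < i)%N -> mdist x y < d ->
    mdist (lift_head x) (f i y) < e.
Proof.
move=> e0.
have : nbh (metric_filt M 2) [set z | forall i j, mdist (z i) (z j) < e].
  by exists e.
move=> /(@fhom_cont _ _ (ft 0%N))[[P Q] /= [[d /= d0 dP] [N N0 NQ]] PQ].
exists d => //; exists N => i x y Ni xy.
pose p : ('I_2 -> L) * ('I_1 -> nat) :=
  (fun k => if unlift ord0 k is Some _ then y else x, fun=> i).
have /PQ /(_ ord0 (lift ord0 ord0)) : P p.1 /\ Q p.2.
  split; last by apply: NQ; exists i.
  (* The distances to bound are 0 or the distance of [x] and [y], in either order. *)
  apply: dP => j k /=; case: unlift => [?|]; case: unlift => [?|];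
    by rewrite ?mdistxx// metric_sym.
by rewrite lift_headE ft_tail /= unlift_none liftK.
Qed.

Lemma lift_head_cvg : {uniform, f @ \oo --> lift_head}.
Proof.
apply/metric_cvg_uniformP => e /lift_head_close[d d0 [N fN]].
by exists N => i x Ni; apply: fN; rewrite ?mdistxx.
Qed.

Lemma lift_head_unif_continuous : unif_continuous lift_head.
Proof.
apply/metric_unif_continuousP => e e0.
have [|d d0 [N fN]] := @lift_head_close (e / 2); first by rewrite divr_gt0.
exists d => // x y xy.
(* The index [N.+1] is the first one past the threshold; [fN] bounds both halves, at the pairs (x,
   y) and (y, y). *)
rewrite (le_lt_trans (metric_triangle _ (f N.+1 y) _))// (splitr e) ltrD//.
  exact: fN.
by rewrite metric_sym fN// mdistxx.
Qed.

End Lift.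

Theorem mainTheorem5 (R : realType) (L M : metricType R) (f : nat -> L -> M)
    (f_unif : forall i, unif_continuous (f i))
    (f_equi : unif_equicontinuous f) :
  let is_lift (ft : shom (sprod (sshift (sfilt_metric L)) sfilt_Ncof_diag)
                         (sshift (sfilt_metric M))) :=
    scomp (sunshift (sfilt_metric M)) ft =
    scomp (seq_shom f_equi)
          (sprod_map (sunshift (sfilt_metric L)) (sid sfilt_Ncof_diag)) in
  ((exists2 finf : L -> M,
      unif_continuous finf & {uniform, f @ \oo --> finf}) <->
   (exists ft, is_lift ft)) /\
  (forall ft, is_lift ft ->
     exists finf : L -> M,
       [/\ unif_continuous finf,
           {uniform, f @ \oo --> finf} &
           forall n, ft n =1 lift_fun f finf (n := n.+1)]).
Proof.
move=> is_lift.
have liftP ft : is_lift ft -> exists finf : L -> M,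
    [/\ unif_continuous finf, {uniform, f @ \oo --> finf} &
        forall n, ft n =1 lift_fun f finf (n := n.+1)].
  move=> ft_lift.
  have ft_tail n (p : ('I_n.+2 -> L) * ('I_n.+1 -> nat)) k :
      ft n p (lift ord0 k) = f (p.2 k) (p.1 (lift ord0 k)).
    (* Coordinate [k] after [sunshift] is coordinate [lift ord0 k] by conversion. *)
    exact: (congr1 (fun h : shom (sprod (sshift (sfilt_metric L))
      sfilt_Ncof_diag) (sfilt_metric M) => h n p k) ft_lift).
  exists (lift_head _ _ _ ft); split.
  - exact: lift_head_unif_continuous ft_tail.
  - exact: lift_head_cvg ft_tail.
  - exact: lift_fun_head.
split=> //; split=> [[finf _ fcvg]|[ft /liftP[finf [? ? _]]]]; last by exists finf.
exists (lift_shom _ _ _ f finf f_equi fcvg); apply: shom_ext => n p.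
(* Forgetting the head leaves only the tail branch of [lift_fun], selected by [liftK]. *)
by apply/funext => k; rewrite /= /lift_fun /= liftK.
Qed.
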